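(* Let $n\ge1$. If $H$ is dense in $\widehat{\mathcal F_n}$, then $\mathrm{Aut}(H)\leqslant\mathrm{Sym}(n)$, i.e. $\mathrm{Aut}(H)$ is isomorphic to a subgroup of the symmetric group $\mathrm{Sym}(n)$. If $H$ is in addition setwise invariant under $\mathrm{Aut}(\widehat{\mathcal F_n})$, as for example $\widehat{\mathcal F_n}$ and $\breve{\mathcal F}_n$ are, then $\mathrm{Aut}(H)=\mathrm{Sym}(n)$ (up to isomorphism).
   Context: Fix $n\ge1$ and symbols $P_1,\dots,P_n$. The partially ordered set $(K_n,\le)$ with valuation map $\mathrm{val}:K_n\to\mathfrak P(\{P_1,\dots,P_n\})$ is the increasing union of finite sets $K_n^d$ ($d\ge 0$) built recursively: $K_n^{-1}=\emptyset$, and $K_n^d\setminus K_n^{d-1}$ consists of exactly one point $w_{\beta,Y}$ for each pair $(\beta,Y)$ such that (i) $Y$ is a decreasing subset of $K_n^{d-1}$ with $Y\not\subseteq K_n^{d-2}$ (for $d=0$ this last condition is void, so $Y=\emptyset$); (ii) $\beta\subseteq\{P_1,\dots,P_n\}$ and $\beta\subseteq\mathrm{val}(w')$ for all $w'\in Y$; (iii) if $Y$ is the decreasing set generated by a single element $w_{\beta',Y'}$, then $\beta\ne\beta'$. One sets $\mathrm{val}(w_{\beta,Y})=\beta$, and $w\le w_{\beta,Y}$ iff $w\in Y$ or $w=w_{\beta,Y}$. $\widehat{\mathcal F_n}:=\mathcal O_\downarrow(K_n,\le)$ is the Heyting algebra of all decreasing subsets of $K_n$ ($\sqcap=\cap$,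 $\sqcup=\cup$, $a\to b$ = the largest decreasing set contained in $(K_n\setminus a)\cup b$). It carries the metric $\mathrm d(a,b)=2^{-\min\{i\in\mathbb N\mid a\cap K_n^i\neq b\cap K_n^i\}}$ ($2^{-\min\emptyset}=0$). ''$H$ is dense in $\widehat{\mathcal F_n}$'' means that $H$ is a Heyting sub-algebra of $\widehat{\mathcal F_n}$ that is dense for this metric. By a theorem of Bellissima, the Heyting sub-algebra $\mathcal F_n$ of $\widehat{\mathcal F_n}$ generated by $g_i=\{w\in K_n: P_i\in\mathrm{val}(w)\}$, $i=1,\dots,n$, is free on $g_1,\dots,g_n$, and it contains all finite decreasing subsets of $K_n$. $\breve{\mathcal F}_n$ denotes the Heyting sub-algebra of $\mathcal F_n$ generated by the principal sets $\{v\in K_n: v\le w\}$, $w\in K_n$ (these are exactly the completely join-irreducible elements of $\mathcal F_n$); equivalently, generated by all finite decreasing subsets of $K_n$. $\mathrm{Aut}$ denotes the group of Heyting algebra automorphisms. *)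

(* Defs.v *)
From HB Require Import structures.
From mathcomp Require Import all_boot all_order all_fingroup all_algebra.
From mathcomp Require Import finmap.
From mathcomp Require Import boolp classical_sets reals.
Set Implicit Arguments.
Unset Strict Implicit.
Unset Printing Implicit Defensive.

Import Order.TTheory GRing.Theory Num.Theory.

Local Open Scope classical_set_scope.

HB.mixin Record TBDistrLattice_isHeyting d (A : Type)
    of Order.TBDistrLattice d A := {
  himp : A -> A -> A;
  lehimp : forall a b c : A, ((c <= himp a b) = (c `&` a <= b))%O
}.

#[short(type="heytingType")]
HB.structure Definition Heyting d :=
  { A of Order.TBDistrLattice d A & TBDistrLattice_isHeyting d A }.

Record is_hmorph d d' (A : heytingType d) (B : heytingType d') (f : A -> B) :
    Prop := IsHMorph {
  hmorph0 : f \bot%O = \bot%O;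
  hmorph1 : f \top%O = \top%O;
  hmorphI : forall x y, f (x `&` y)%O = (f x `&` f y)%O;
  hmorphU : forall x y, f (x `|` y)%O = (f x `|` f y)%O;
  hmorph_imp : forall x y, f (himp x y) = himp (f x) (f y)
}.

Record hAut d (A : heytingType d) := HAut {
  haut_fun :> A -> A;
  haut_bij : bijective haut_fun;
  haut_morph : is_hmorph haut_fun
}.

Section HAutGroup.
Context {d : Order.disp_t} {A : heytingType d}.
Implicit Types f g h : hAut A.

Lemma haut_ext f g : f =1 g -> f = g.
Proof.
case: f g => [f bf mf] [g bg mg] /= /funext e; subst g.
by congr HAut; exact: Prop_irrelevance.
Qed.

Definition haut1 : hAut A.
Proof. by exists id; [exists id | split]. Defined.

Definition hautM f g : hAut A.
Proof.
exists (f \o g); first exact: bij_comp (haut_bij f) (haut_bij g).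
case: (haut_morph f) (haut_morph g) => f0 f1 fI fU fi [g0 g1 gI gU gi].
by split=> [||x y|x y|x y] /=;
  rewrite ?g0 ?g1 ?gI ?gU ?gi ?f0 ?f1 ?fI ?fU ?fi.
Defined.

Lemma haut_inv_subproof f : {g : hAut A | cancel f g /\ cancel g f}.
Proof.
have /cid[g [fg gf]] : exists g : A -> A, cancel f g /\ cancel g f.
  by case: (haut_bij f) => g fg gf; exists g.
have [f0 f1 fI fU fi] := haut_morph f.
have mg : is_hmorph g.
  split=> [||x y|x y|x y]; apply: (can_inj fg); rewrite !gf //.
  - by rewrite fI !gf.
  - by rewrite fU !gf.
  - by rewrite fi !gf.
by exists (HAut (Bijective gf fg) mg).
Qed.

Definition hautV f : hAut A := sval (haut_inv_subproof f).

HB.instance Definition _ := gen_eqMixin (hAut A).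
HB.instance Definition _ := gen_choiceMixin (hAut A).

Lemma hautMA : associative hautM. Proof. by move=> f g h; exact: haut_ext. Qed.
Lemma hautM1l : left_id haut1 hautM. Proof. by move=> f; exact: haut_ext. Qed.
Lemma hautM1r : right_id haut1 hautM. Proof. by move=> f; exact: haut_ext. Qed.
Lemma hautVM : left_inverse haut1 hautV hautM.
Proof.
by move=> f; apply: haut_ext => x /=; rewrite /hautV;
  case: haut_inv_subproof => g [].
Qed.
Lemma hautMV : right_inverse haut1 hautV hautM.
Proof.
by move=> f; apply: haut_ext => x /=; rewrite /hautV;
  case: haut_inv_subproof => g [].
Qed.

HB.instance Definition _ :=
  isGroup.Build (hAut A) hautMA hautM1l hautM1r hautVM hautMV.

End HAutGroup.

(* In {perm 'I_n} the product s * t is "s, then t", whereas in [hAut A] f * g is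
   "g, then f"; existence of an embedding or isomorphism is unaffected, as every
   group is isomorphic to its opposite. *)
Definition isog_perm_subgroup (G : groupType) (n : nat) : Prop :=
  exists (S : {group {perm 'I_n}}) (f : {multiplicative G -> {perm 'I_n}}),
    injective f /\ range f = [set` S].

Definition isog_Sym (G : groupType) (n : nat) : Prop :=
  exists f : {multiplicative G -> {perm 'I_n}}, bijective f.

Record subheyting_closed d (A : heytingType d) (H : set A) : Prop :=
    SubHeytingClosed {
  shc0 : H \bot%O;
  shc1 : H \top%O;
  shcI : forall x y, H x -> H y -> H (x `&` y)%O;
  shcU : forall x y, H x -> H y -> H (x `|` y)%O;
  shc_imp : forall x y, H x -> H y -> H (himp x y)
}.

Record subHeyting d (A : heytingType d) := SubHeyting {
  sh_set :> set A;
  sh_closed : subheyting_closed sh_set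
}.

Definition sh_type d (A : heytingType d) (H : subHeyting A) : Type :=
  set_type (sh_set H).

Section SubHeytingInstances.
Context {d : Order.disp_t} {A : heytingType d} (H : subHeyting A).
Local Notation T := (sh_type H).

HB.instance Definition _ := SubChoice.on T.

Let memH : pred A := fun x => x \in sh_set H.

Let memH_meet : @Order.ClosedPredicates.meet_closed d A memH.
Proof.
by move=> x y /set_mem hx /set_mem hy; apply/mem_set; exact: (shcI (sh_closed H)).
Qed.

Let memH_join : @Order.ClosedPredicates.join_closed d A memH.
Proof.
by move=> x y /set_mem hx /set_mem hy; apply/mem_set; exact: (shcU (sh_closed H)).
Qed.

Let memH_bot : \bot%O \in memH.
Proof. by apply/mem_set; exact: (shc0 (sh_closed H)). Qed.

Let memH_top : \top%O \in memH.
Proof. by apply/mem_set; exact: (shc1 (sh_closed H)). Qed.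

HB.instance Definition _ :=
  Order.SubChoice_isTBSubLattice.Build d A memH d T
    memH_meet memH_join memH_bot memH_top.

Lemma sh_leE (x y : T) : (x <= y)%O = (val x <= val y)%O.
Proof. by []. Qed.

Lemma sh_val0 : val (\bot%O : T) = \bot%O.
Proof. by []. Qed.

Lemma sh_val1 : val (\top%O : T) = \top%O.
Proof. by []. Qed.

Lemma sh_valI (x y : T) : val (x `&` y)%O = (val x `&` val y)%O.
Proof. by []. Qed.

Lemma sh_valU (x y : T) : val (x `|` y)%O = (val x `|` val y)%O.
Proof. by []. Qed.

Let sh_meetUl : @left_distributive T T Order.meet Order.join.
Proof. by move=> x y z; apply: val_inj; rewrite !(sh_valI, sh_valU) meetUl. Qed.

Let sh_joinIl : @left_distributive T T Order.join Order.meet.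
Proof. by move=> x y z; apply: val_inj; rewrite !(sh_valI, sh_valU) joinIl. Qed.

HB.instance Definition _ :=
  Order.Lattice_isDistributive.Build d T sh_meetUl sh_joinIl.

Definition sh_imp (x y : T) : T :=
  exist _ (himp (val x) (val y))
    (mem_set (shc_imp (sh_closed H) (set_mem (valP x)) (set_mem (valP y)))).

Let le_sh_imp (a b c : T) : ((c <= sh_imp a b) = (c `&` a <= b))%O.
Proof. by rewrite !sh_leE sh_valI lehimp. Qed.

HB.instance Definition _ := TBDistrLattice_isHeyting.Build d T le_sh_imp.

End SubHeytingInstances.

Section Generated.
Context {d : Order.disp_t} {A : heytingType d}.

Lemma setT_subheyting : subheyting_closed [set: A].
Proof. by []. Qed.

Definition sh_full : subHeyting A := SubHeyting setT_subheyting.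

Lemma gen_subheyting (S : set A) :
  subheyting_closed (\bigcap_(H in [set H : subHeyting A | S `<=` H]) sh_set H).
Proof.
split=> [H _|H _|x y hx hy H SH|x y hx hy H SH|x y hx hy H SH].
- exact: shc0 (sh_closed H).
- exact: shc1 (sh_closed H).
- by apply: (shcI (sh_closed H)); [exact: hx | exact: hy].
- by apply: (shcU (sh_closed H)); [exact: hx | exact: hy].
- by apply: (shc_imp (sh_closed H)); [exact: hx | exact: hy].
Qed.

Definition sh_gen (S : set A) : subHeyting A := SubHeyting (gen_subheyting S).

Lemma sub_subheyting (H : subHeyting A) (L : subHeyting (sh_type H)) :
  subheyting_closed [set val x | x in sh_set L].
Proof.
have [L0 L1 LI LU Li] := sh_closed L.
split=> [||_ _ [x Lx <-] [y Ly <-]|_ _ [x Lx <-] [y Ly <-]|_ _ [x Lx <-] [y Ly <-]].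
- by exists \bot%O => //; exact: sh_val0.
- by exists \top%O => //; exact: sh_val1.
- by exists (x `&` y)%O; [exact: LI | exact: sh_valI].
- by exists (x `|` y)%O; [exact: LU | exact: sh_valU].
- by exists (himp x y); [exact: Li |].
Qed.

Definition sh_sub (H : subHeyting A) (L : subHeyting (sh_type H)) :
  subHeyting A := SubHeyting (sub_subheyting L).

End Generated.

Arguments sh_full {d} A.

(* The point w_{beta,Y} is coded by the natural number [pnt beta Y]; [pickle]
   being injective, distinct pairs give distinct points.  [lab] and [low] recover
   beta and Y from the code.  The symbols P_1, ..., P_n are the elements of
   'I_n. *)
Section Codes.
Variable n : nat.
Implicit Types (beta : {set 'I_n}) (Y : {fset nat}) (S : set nat).

Definition pnt beta Y : nat := choice.pickle (beta, Y).

Definition unpnt (w : nat) : {set 'I_n} * {fset nat} :=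
  odflt (finset.set0, fset0) (choice.unpickle w).

Definition lab (w : nat) : {set 'I_n} := (unpnt w).1.

Definition low (w : nat) : {fset nat} := (unpnt w).2.

Lemma lab_pnt beta Y : lab (pnt beta Y) = beta.
Proof. by rewrite /lab /unpnt /pnt choice.pickleK. Qed.

Lemma low_pnt beta Y : low (pnt beta Y) = Y.
Proof. by rewrite /low /unpnt /pnt choice.pickleK. Qed.

Definition code_le (v w : nat) : Prop := v \in low w \/ v = w.

(* The condition for w_{beta,Y} to be a point of K_n^d \ K_n^{d-1}, where S is
   K_n^{d-1}; [fresh] is the requirement that Y is not contained in K_n^{d-2}.
   [adm_neq]: if Y is generated by w alone, then beta differs from val(w). *)
Record admissible S (fresh : Prop) beta Y : Prop := Admissible {
  adm_sub : [set` Y] `<=` S;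
  adm_decr : forall v w, S v -> w \in Y -> code_le v w -> v \in Y;
  adm_fresh : fresh;
  adm_lab : forall w, w \in Y -> beta \subset lab w;
  adm_neq : forall w, S w -> [set` Y] = [set v | S v /\ code_le v w] ->
    beta <> lab w
}.

(* [stage k] is K_n^{k-1}, so that [stage 0] is K_n^{-1}. *)
Fixpoint stage (k : nat) : set nat :=
  if k is k'.+1 then
    stage k' `|` [set w | exists beta Y, w = pnt beta Y /\
      admissible (stage k')
        (if k' is k''.+1 then ~ ([set` Y] `<=` stage k'') else True) beta Y]
  else set0.

Lemma stage_low k v w : stage k w -> v \in low w -> stage k v.
Proof.
elim: k => [//|k IH] /= [kw vw|[beta [Y [-> [sub _ _ _ _]]]]]; first by left; exact: IH.
by rewrite low_pnt => vY; left; exact: sub.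
Qed.

Lemma stage_admissible k w : stage k w ->
  exists k' fresh, admissible (stage k') fresh (lab w) (low w).
Proof.
elim: k => [//|k IH] /= [/IH//|[beta [Y [-> adm]]]].
by rewrite lab_pnt low_pnt; do 2!eexists; exact: adm.
Qed.

Lemma stage_low_irrefl k v w : stage k v -> stage k w ->
  v \in low w -> ~ w \in low v.
Proof.
elim: k => [//|k IH] kv kw vw wv; have kwv : stage k w -> False.
  by move=> kw'; apply: (IH _ kw' vw wv); exact: stage_low kw' vw.
case: kw => [//|[beta [Y [wE [sub _ _ _ _]]]]]; apply: kwv.
by apply: stage_low wv; apply: sub => /=; rewrite -(low_pnt beta Y) -wE.
Qed.

Lemma stage_le k k' : (k <= k')%N -> stage k `<=` stage k'.
Proof.
by move/subnKC <-; elim: (k' - k)%N => [|m IH] w kw;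
  rewrite ?addn0 ?addnS//; left; exact: IH.
Qed.

End Codes.

Definition K (n : nat) : Type := set_type (\bigcup_k stage n k).

HB.instance Definition _ n := SubChoice.on (K n).

Section Kn.
Variable n : nat.
Implicit Types (v w : K n) (a b c : set (K n)).

Definition Kval w : {set 'I_n} := lab n (val w).

Definition Kle v w : Prop := code_le n (val v) (val w).

Definition Klevel (d : nat) : set (K n) := [set w | stage n d.+1 (val w)].

Lemma K_admissible w :
  exists k fresh, admissible (stage n k) fresh (lab n (val w)) (low n (val w)).
Proof. by have [k _] := set_mem (valP w); exact: stage_admissible. Qed.

Lemma Kle_refl w : Kle w w.
Proof. by right. Qed.

Lemma Kle_trans u v w : Kle u v -> Kle v w -> Kle u w.
Proof.
move=> uv [vw|vw]; last by rewrite /Kle -vw.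
have [k [fresh [sub decr _ _ _]]] := K_admissible w.
left; apply: (decr _ _ _ vw uv).
by case: uv => [|->]; [apply: stage_low|]; exact: sub vw.
Qed.

Lemma Kle_anti v w : Kle v w -> Kle w v -> v = w.
Proof.
case=> [vw|vw]; last by move=> _; exact: val_inj.
case=> [wv|wv]; last exact: val_inj.
have [i _ iv] := set_mem (valP v); have [j _ jw] := set_mem (valP w).
case: (@stage_low_irrefl n (maxn i j) (val v) (val w)) => //.
- exact: stage_le (leq_maxl i j) _ iv.
- exact: stage_le (leq_maxr i j) _ jw.
Qed.

Lemma Kval_anti v w : Kle v w -> Kval w \subset Kval v.
Proof.
case=> [vw|vw]; last by rewrite /Kval vw.
by have [k [fresh [_ _ _ labv _]]] := K_admissible w; exact: labv.
Qed.

Definition decreasing a : Prop := forall v w, Kle v w -> a w -> a v.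

Definition Fhat : Type := set_type decreasing.

HB.instance Definition _ := SubChoice.on Fhat.

Definition MkFhat a (da : decreasing a) : Fhat := exist _ a (mem_set da).

Let memD : pred (set (K n)) := fun a => a \in (decreasing : set (set (K n))).

Let memD_meet : @Order.ClosedPredicates.meet_closed set_display (set (K n)) memD.
Proof.
move=> a b /set_mem ha /set_mem hb; apply/mem_set => v w vw [aw bw].
by split; [exact: ha vw aw | exact: hb vw bw].
Qed.

Let memD_join : @Order.ClosedPredicates.join_closed set_display (set (K n)) memD.
Proof.
move=> a b /set_mem ha /set_mem hb; apply/mem_set => v w vw [aw|bw].
- by left; exact: ha vw aw.
- by right; exact: hb vw bw.
Qed.

Let memD_bot : \bot%O \in memD.
Proof. by apply/mem_set => v w _ []. Qed.

Let memD_top : \top%O \in memD.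
Proof. by apply/mem_set. Qed.

HB.instance Definition _ :=
  Order.SubChoice_isTBSubLattice.Build set_display (set (K n)) memD
    set_display Fhat memD_meet memD_join memD_bot memD_top.

Lemma Fhat_leE (x y : Fhat) : (x <= y)%O = (val x <= val y)%O.
Proof. by []. Qed.

Lemma Fhat_val0 : val (\bot%O : Fhat) = \bot%O.
Proof. by []. Qed.

Lemma Fhat_val1 : val (\top%O : Fhat) = \top%O.
Proof. by []. Qed.

Lemma Fhat_valI (x y : Fhat) : val (x `&` y)%O = (val x `&` val y)%O.
Proof. by []. Qed.

Lemma Fhat_valU (x y : Fhat) : val (x `|` y)%O = (val x `|` val y)%O.
Proof. by []. Qed.

Let Fhat_meetUl : @left_distributive Fhat Fhat Order.meet Order.join.
Proof. by move=> x y z; apply: val_inj; rewrite !(Fhat_valI, Fhat_valU) meetUl. Qed.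

Let Fhat_joinIl : @left_distributive Fhat Fhat Order.join Order.meet.
Proof. by move=> x y z; apply: val_inj; rewrite !(Fhat_valI, Fhat_valU) joinIl. Qed.

HB.instance Definition _ :=
  Order.Lattice_isDistributive.Build set_display Fhat Fhat_meetUl Fhat_joinIl.

Definition dimp a b : set (K n) :=
  \bigcup_(c in [set c | decreasing c /\ c `<=` ~` a `|` b]) c.

Lemma dimp_decreasing a b : decreasing (dimp a b).
Proof. by move=> v w vw [c [dc cab] cw]; exists c => //; exact: dc vw cw. Qed.

Definition Fhat_imp (a b : Fhat) : Fhat :=
  MkFhat (@dimp_decreasing (val a) (val b)).

Let le_Fhat_imp (a b c : Fhat) : ((c <= Fhat_imp a b) = (c `&` a <= b))%O.
Proof.
rewrite !Fhat_leE Fhat_valI; apply/idP/idP => /subsetPset h; apply/subsetPset.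
- by move=> w [/h[e [_ /(_ w) eab] ew] aw]; case: (eab ew).
- move=> w cw; exists (val c) => //; split; first exact: set_mem (valP c).
  move=> v cv; have [av|nav] := EM (val a v); last by left.
  by right; apply: h.
Qed.

HB.instance Definition _ :=
  TBDistrLattice_isHeyting.Build set_display Fhat le_Fhat_imp.

Lemma gen_decreasing (i : 'I_n) : decreasing [set w | i \in Kval w].
Proof. by move=> v w /Kval_anti /fintype.subsetP; exact. Qed.

Definition Fgen (i : 'I_n) : Fhat := MkFhat (@gen_decreasing i).

Lemma principal_decreasing w : decreasing [set v | Kle v w].
Proof. by move=> u v uv vw; exact: Kle_trans uv vw. Qed.

Definition principal w : Fhat := MkFhat (@principal_decreasing w).

Definition Ffree : subHeyting Fhat := sh_gen (range Fgen).

Definition Fbreve : subHeyting Fhat :=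
  sh_sub (sh_gen [set x : sh_type Ffree | exists w, val x = principal w]).

Definition differ (a b : Fhat) (i : nat) : bool :=
  `[< val a `&` Klevel i <> val b `&` Klevel i >].

Definition Fdist (R : realType) (a b : Fhat) : R :=
  if pselect (exists i, differ a b i) is left ex then (2 ^- ex_minn ex)%R
  else 0%R.

Definition metric_dense (R : realType) (H : set Fhat) : Prop :=
  forall (a : Fhat) (e : R), (0 < e)%R -> exists2 h, H h & (Fdist R a h < e)%R.

Definition aut_invariant (H : set Fhat) : Prop :=
  forall f : hAut Fhat, f @` H = H.

End Kn.

(* Main.v *)
(* A dense H contains every finite decreasing set, because these are isolated
   points of the metric space.  Hence an automorphism of H permutes the principal
   sets, i.e. it is induced by an order automorphism phi of K_n.  The order of
   K_n remembers the labels up to a permutation of the symbols: call u a cover of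
   Z if Z is the set of points strictly below u.  The down-set of w has one cover
   for each proper subset of val(w); so val(w) is empty iff there is no cover, and
   is a singleton iff there is exactly one, whence phi permutes the minimal points
   u_i labelled by {P_i}.  If u_i is not below w, the down-set of {w, u_i} has one
   cover for each subset of the intersection of val(w) and {P_i}, hence two of
   them iff P_i belongs to val(w); if u_i is below w, then val(w) is {P_i} or
   empty.  So val(phi w) is the image of val(w) under a fixed permutation, which
   determines phi by well-founded recursion; conversely every permutation of the
   symbols extends to K_n by the same recursion.  That the principal sets lie in
   F_n is seen from the de Jongh formulas. *)
Require Import Defs.
From HB Require Import structures.
From mathcomp Require Import all_boot all_order all_fingroup all_algebra.
From mathcomp Require Import finmap.
From mathcomp Require Import boolp classical_sets cardinality reals.
Set Implicit Arguments.
Unset Strict Implicit.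
Unset Printing Implicit Defensive.

Import Order.TTheory GRing.Theory Num.Theory.

(** * The poset K_n freed from its coding: well-foundedness, extensionality, existence of points *)

Section Poset.
Context {n : nat}.
Implicit Types (v w u : K n) (Y : set (K n)) (b : {set 'I_n}).

Local Open Scope classical_set_scope.

Lemma stage_lowS k (x y : nat) :
  stage n k.+1 x -> y \in low n x -> stage n k y.
Proof.
elim: k x y => [|k IH] x y [//|].
- by case=> [b [Y [-> [sub _ _ _ _]]]]; rewrite low_pnt => /sub.
- by move=> kx xy; left; exact: IH kx xy.
- by case=> [b [Y [-> [sub _ _ _ _]]]]; rewrite low_pnt => /sub.
Qed.

Lemma stage_ext k (x y : nat) : stage n k x -> stage n k y ->
  lab n x = lab n y -> low n x = low n y -> x = y.
Proof.
have pntE z : stage n k z -> z = pnt (lab n z) (low n z).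
  elim: k => [//|k IH] [/IH//|[b [Y [-> _]]]].
  by rewrite lab_pnt low_pnt.
by move=> /pntE -> /pntE -> /=; rewrite !(lab_pnt, low_pnt) => -> ->.
Qed.

Lemma finite_stage k : finite_set (stage n k).
Proof.
elim: k => [|k /finite_fsetP[X XE]]; first exact: finite_set0.
rewrite /= finite_setU; split; first by rewrite XE; exact: finite_fset.
pose C := [set (b : {set 'I_n}, Y : {fset nat}) |
  b in [set: {set 'I_n}] & Y in [set` fpowerset X]].
apply: (@sub_finite_set _ _ ((fun p : {set 'I_n} * {fset nat} => pnt p.1 p.2) @` C)).
  move=> _ [b [Y [-> [sub _ _ _ _]]]]; exists (b, Y) => //.
  exists b => //; exists Y => //=; rewrite fpowersetE; apply/fsubsetP => z zY.
  by have := sub z zY; rewrite XE.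
apply: finite_image; apply: finite_image2; first exact: finite_finset.
exact: finite_fset.
Qed.

Lemma K_in_stage w : exists k, stage n k (val w).
Proof. by have [k _] := set_mem (valP w); exists k. Qed.

Lemma stage_K k x : stage n k x -> exists w, val w = x.
Proof.
move=> kx; have xK : x \in \bigcup_k stage n k by apply/mem_set; exists k.
by exists (exist _ x xK).
Qed.

Definition Klt v w : Prop := val v \in low n (val w).

Lemma KleE v w : Kle v w <-> Klt v w \/ v = w.
Proof.
split=> [[vw|/val_inj ->]|[vw|->]]; [by left|by right|by left|exact: Kle_refl].
Qed.

Lemma KltW v w : Klt v w -> Kle v w.
Proof. by left. Qed.

Lemma low_Klt w x : x \in low n (val w) -> exists2 v, Klt v w & val v = x.
Proof.
move=> xw; have [k kw] := K_in_stage w.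
have [v vE] := stage_K (stage_low kw xw).
by exists v; rewrite /Klt ?vE.
Qed.

(** The stage index serves as a rank: by [stage_lowS] it drops along [Klt]. *)
Lemma Klt_wf : well_founded Klt.
Proof.
move=> w; have [k] := K_in_stage w.
elim: k w => [//|k IH] w kw; constructor => v vw.
by apply: IH; exact: stage_lowS kw vw.
Qed.

Lemma Klt_irr w : ~ Klt w w.
Proof. by move=> ww; have [k kw] := K_in_stage w; exact: (stage_low_irrefl kw kw ww). Qed.

Lemma Klt_neqle v w : Klt v w <-> v <> w /\ Kle v w.
Proof.
split=> [vw|[vw /KleE[]//]]; split; last exact: KltW.
by move=> vE; rewrite vE in vw; exact: Klt_irr vw.
Qed.

Lemma Kle_lt_trans u v w : Kle u v -> Klt v w -> Klt u w.
Proof.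
move=> uv vw; apply/Klt_neqle; split; last exact: Kle_trans uv (KltW vw).
move=> uw; rewrite uw in uv; apply: (@Klt_irr v).
by rewrite {2}(Kle_anti (KltW vw) uv).
Qed.

Lemma Klt_le_trans u v w : Klt u v -> Kle v w -> Klt u w.
Proof. by move=> uv /KleE[vw|<-//]; apply: Kle_lt_trans vw; exact: KltW. Qed.

Lemma K_minimal (P : set (K n)) w : P w ->
  exists v, [/\ Kle v w, P v & forall u, Klt u v -> ~ P u].
Proof.
elim/(well_founded_ind Klt_wf): w => w IH Pw.
have [[v [vw Pv]]|nP] := EM (exists v, Klt v w /\ P v).
  have [u [uv Pu um]] := IH v vw Pv.
  by exists u; split=> //; exact: Kle_trans uv (KltW vw).
by exists w; split=> // [|v vw Pv]; [exact: Kle_refl | apply: nP; exists v].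
Qed.

Lemma K_ext v w : Kval v = Kval w -> (forall u, Klt u v <-> Klt u w) -> v = w.
Proof.
move=> vw ltvw; apply: val_inj; have [i iv] := K_in_stage v.
have [j jw] := K_in_stage w.
apply: (@stage_ext (maxn i j)) => //.
- exact: stage_le (leq_maxl i j) _ iv.
- exact: stage_le (leq_maxr i j) _ jw.
- apply/fsetP => x; apply/idP/idP => /[dup] xl /low_Klt[u uv ux];
    by rewrite -ux; apply/ltvw.
Qed.

Lemma finite_Klt w : finite_set [set v | Klt v w].
Proof.
apply: (@finite_preimage _ _ [set` low n (val w)] (fun v : K n => val v)).
  by move=> u v _ _; exact: val_inj.
exact: finite_fset.
Qed.

Lemma finite_Kle w : finite_set [set v | Kle v w].
Proof.
have -> : [set v | Kle v w] = [set v | Klt v w] `|` [set w].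
  by apply/seteqP; split=> v /KleE.
by rewrite finite_setU; split; [exact: finite_Klt | exact: finite_set1].
Qed.

Lemma finite_Klevel d : finite_set (Klevel (n := n) d).
Proof.
apply: (@finite_preimage _ _ (stage n d.+1) (fun v : K n => val v)).
  by move=> u v _ _; exact: val_inj.
exact: finite_stage.
Qed.

Lemma stage_bounded (X : {fset nat}) : (forall x, x \in X -> exists k, stage n k x) ->
  exists k, [set` X] `<=` stage n k.
Proof.
move=> Xk; have /choice[f fP] (x : nat) : exists k, x \in X -> stage n k x.
  have [/Xk[k kx]|xX] := boolP (x \in X); first by exists k.
  by exists 0.
exists (\max_(x <- X) f x) => x /= xX.
apply: stage_le (fP x xX); exact: (@leq_bigmax_seq _ _ xpredT).
Qed.

(** Condition (iii) of the construction without stages: a point just above a principal down-set must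
    change the label. *)
Lemma Kval_neq v w : (forall u, Klt u v <-> Kle u w) -> Kval v <> Kval w.
Proof.
move=> lo; have [k [fr [sub _ _ _ neq]]] := K_admissible v.
have wv : Klt w v by apply/lo; exact: Kle_refl.
have kw := sub _ wv.
apply: neq kw _; apply/seteqP; split=> x /=.
  move=> xv; split; first exact: sub.
  by have [u uv <-] := low_Klt xv; apply/lo.
move=> [kx xw]; have [u uE] := stage_K kx; rewrite -uE.
by apply/lo; rewrite /Kle uE.
Qed.

(** Together with [K_ext] this describes K_n without levels: points are pairs of a label and a
    finite decreasing set subject to (ii) and (iii). The level is recovered from the least stage
    containing [Y]. *)
Lemma K_exists b Y : finite_set Y -> decreasing Y ->
  (forall v, Y v -> b \subset Kval v) ->
  (forall w, (forall v, Y v <-> Kle v w) -> b <> Kval w) ->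
  exists w, Kval w = b /\ forall v, Klt v w <-> Y v.
Proof.
move=> finY dY bY bneq.
have /finite_fsetP[X XE] : finite_set ((fun v : K n => val v) @` Y).
  exact: finite_image.
have XP v : val v \in X <-> Y v.
  have -> : (val v \in X) = [set` X] (val v) :> Prop by [].
  rewrite -XE; split=> [[v' Yv' /val_inj <-]//|Yv]; by exists v.
have XK x : x \in X -> exists2 v, Y v & val v = x.
  by move=> xX; have : [set` X] x by []; rewrite -XE => -[v]; exists v.
(* Minimality of [k] is what yields freshness: the set does not lie in the preceding stage. *)
have [k kX kmin] : exists2 k, [set` X] `<=` stage n k &
    forall j, (j < k)%N -> ~ [set` X] `<=` stage n j.
  have exk : exists k, `[< [set` X] `<=` stage n k >].
    have [x /XK[v _ <-]|k kX] := @stage_bounded X; first exact: K_in_stage.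
    by exists k; apply/asboolP.
  exists (ex_minn exk); case: ex_minnP => k /asboolP kX km // j jk jX.
  by have /asboolP/km := jX; rewrite leqNgt jk.
have xstage : stage n k.+1 (pnt b X).
  right; exists b, X; split=> //; split=> //.
  - move=> x y kx /XK[w Yw <-] xw; have [v vE] := stage_K kx.
    by rewrite -vE; apply/XP; apply: dY Yw; rewrite /Kle vE.
  - by case: {kX} k kmin => // k; exact.
  - by move=> x /XK[w Yw <-]; exact: bY.
  - move=> x kx XxE; have [w wE] := stage_K kx; rewrite -wE; apply: bneq => v.
    rewrite -XP; have -> : (val v \in X) = [set` X] (val v) :> Prop by [].
    rewrite XxE /= -wE; split=> [[]//|vw]; split=> //.
    by case: vw => [|->]; [apply: stage_low|]; rewrite wE.
have [w wE] := stage_K xstage; exists w; split; first by rewrite /Kval wE lab_pnt.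
by move=> v; rewrite /Klt wE low_pnt.
Qed.

(** Freshness bounds the level from above: for k > 0, a point entering at stage k+1 has a strict
    lower set not contained in stage k-1, so a lower set inside stage d+1 forces k <= d+1. *)
Lemma Klevel_low d w : (forall v, Klt v w -> Klevel d v) -> Klevel d.+1 w.
Proof.
move=> low_d; have [k kw] := K_in_stage w.
rewrite /Klevel /=; move: kw; elim: k => [//|k IH] [//|[b [Y [wE adm]]]].
have YE : low n (val w) = Y by rewrite wE low_pnt.
have Yd : [set` Y] `<=` stage n d.+1.
  by move=> x /=; rewrite -YE => /low_Klt[v vw <-]; exact: low_d.
have wk : stage n k.+1 (val w) by right; exists b, Y.
suff kd : (k <= d.+1)%N by have := @stage_le n k.+1 d.+2 kd _ wk.
case: k {IH wk} adm => // k [_ _ fr _ _]; rewrite leqNgt; apply/negP => dk; apply: fr.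
by apply: subset_trans Yd _; exact: stage_le.
Qed.

End Poset.

(** * The action of Sym(n) on K_n *)

Section Action.
Context {n : nat}.
Implicit Types (s t : {perm 'I_n}) (u v w x : K n).

Local Open Scope classical_set_scope.

(** The point [w] is only the default of [xget]; [actP] shows that the point asked for always
    exists. *)
Definition act s : K n -> K n :=
  Fix Klt_wf (fun=> K n) (fun w rec => xget w [set u | Kval u = s @: Kval w /\
    forall x, Klt x u <-> exists v (vw : Klt v w), x = rec v vw]).

Definition act_good s w := Kval (act s w) = s @: Kval w /\
  forall x, Klt x (act s w) <-> exists2 v, Klt v w & x = act s v.

Lemma act_good_exists s w :
  (exists u, Kval u = s @: Kval w /\
     forall x, Klt x u <-> exists2 v, Klt v w & x = act s v) -> act_good s w.
Proof.
move=> [u uP]; have actE : act s w = xget w [set u | Kval u = s @: Kval w /\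
    forall x, Klt x u <-> exists v (vw : Klt v w), x = act s v].
  rewrite {1}/act Fix_eq // => x f g fg; suff -> : f = g by [].
  by apply: functional_extensionality_dep => v; apply: funext => vx; exact: fg.
rewrite /act_good actE.
set P := (X in xget w X).
have : P u.
  split=> [|x]; first exact: uP.1.
  by rewrite uP.2; split=> [[v vw ->]|[v [vw ->]]]; exists v.
case: xgetP => [y _ [yv ylt] _|yn /yn//]; split=> // x.
by rewrite ylt; split=> [[v [vw ->]]|[v vw ->]]; exists v.
Qed.

(** Relativizing to [D] avoids a circle: the induction in [actP] needs injectivity strictly below
    [w], where alone [act_good] is known so far. *)
Lemma act_inj_on s (D : set (K n)) : decreasing D ->
  (forall v, D v -> act_good s v) ->
  forall v w, D v -> D w -> act s v = act s w -> v = w.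
Proof.
move=> dD Dgood; elim/(well_founded_ind (@Klt_wf n)) => v IH w Dv Dw vw.
have [vval vlt] := Dgood v Dv; have [wval wlt] := Dgood w Dw.
apply: K_ext => [|u].
  by apply: (imset_inj (@perm_inj _ s)); rewrite -vval -wval vw.
split=> [uv|uw].
- have : Klt (act s u) (act s w) by rewrite -vw; apply/vlt; exists u.
  move=> /wlt[u' u'w uu']; rewrite (IH u uv u' _ _ uu') //.
  + exact: dD (KltW uv) Dv.
  + exact: dD (KltW u'w) Dw.
- have : Klt (act s u) (act s v) by rewrite vw; apply/wlt; exists u.
  move=> /vlt[u' u'v uu']; rewrite -(IH u' u'v u _ _ (esym uu')) //.
  + exact: dD (KltW u'v) Dv.
  + exact: dD (KltW uw) Dw.
Qed.

Lemma actP s w : act_good s w.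
Proof.
elim/(well_founded_ind (@Klt_wf n)): w => w IH; apply: act_good_exists.
have injw v v' : Klt v w -> Klt v' w -> act s v = act s v' -> v = v'.
  by apply: (act_inj_on (D := [set v | Klt v w])) => // x y; exact: Kle_lt_trans.
have [||||u [uval ult]] := @K_exists n (s @: Kval w) (act s @` [set v | Klt v w]).
- by apply: finite_image; exact: finite_Klt.
- move=> x y /KleE[xy|->//] [v vw vy]; have [_ vlt] := IH v vw.
  move: xy; rewrite -vy => /vlt[z zv ->]; exists z => //=.
  exact: Kle_lt_trans (KltW zv) vw.
- move=> _ [v vw <-]; have [-> _] := IH v vw.
  by apply: imsetS; exact: Kval_anti (KltW vw).
(* Condition (iii): if the image is generated by one point [act s v], injectivity shows that [v]
   generates the strict lower set of [w], and [Kval_neq] separates the labels. *)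
- move=> x xP; have [v vw vx] : (act s @` [set v | Klt v w]) x.
    by apply/xP; exact: Kle_refl.
  have [vval vlt] := IH v vw; rewrite -vx vval => /(imset_inj (@perm_inj _ s)).
  apply: Kval_neq => u; split=> [uw|uv]; last exact: Kle_lt_trans uv vw.
  have /xP : (act s @` [set v | Klt v w]) (act s u) by exists u.
  rewrite -vx => /KleE[/vlt[z zv uz]|/injw -> //]; last exact: Kle_refl.
  by rewrite (injw u z) //; [exact: KltW|exact: Kle_lt_trans (KltW zv) vw].
exists u; split=> // x; rewrite ult.
by split=> [[v vw <-]|[v vw ->]]; exists v.
Qed.

Lemma Kval_act s w : Kval (act s w) = s @: Kval w.
Proof. by have [] := actP s w. Qed.

Lemma Klt_actP s w x : Klt x (act s w) <-> exists2 v, Klt v w & x = act s v.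
Proof. by have [] := actP s w. Qed.

Lemma act_inj s : injective (act s).
Proof. by move=> v w; apply: (act_inj_on (D := setT)) => // u _; exact: actP. Qed.

Lemma Klt_act s v w : Klt (act s v) (act s w) <-> Klt v w.
Proof.
split=> [/Klt_actP[u uw /act_inj -> //]|vw]; by apply/Klt_actP; exists v.
Qed.

Lemma Kle_act s v w : Kle (act s v) (act s w) <-> Kle v w.
Proof.
rewrite !KleE Klt_act; split=> -[vw|vw]; [by left| |by left|by right; rewrite vw].
by right; exact: act_inj vw.
Qed.

Lemma actM s t w : act t (act s w) = act (s * t)%g w.
Proof.
elim/(well_founded_ind (@Klt_wf n)): w => w IH; apply: K_ext => [|u].
  by rewrite !Kval_act -imset_comp; apply: eq_imset => i /=; rewrite permM.
rewrite !Klt_actP; split=> [[_ /Klt_actP[v vw ->] ->]|[v vw ->]].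
  by exists v => //; exact: IH.
by exists (act s v); [apply/Klt_act|rewrite IH].
Qed.

Lemma act1 w : act 1%g w = w.
Proof. by apply: (@act_inj 1%g); rewrite actM mulg1. Qed.

Lemma actK s : cancel (act s) (act s^-1%g).
Proof. by move=> w; rewrite actM mulgV act1. Qed.

Lemma actKV s : cancel (act s^-1%g) (act s).
Proof. by move=> w; rewrite actM mulVg act1. Qed.

Lemma minimal_exists (b : {set 'I_n}) :
  exists w, Kval w = b /\ (forall v, ~ Klt v w).
Proof.
have [||||w [wb wlt]] := @K_exists n b set0 => //.
- by move=> w /(_ w)[_ /(_ (Kle_refl w))].
- by exists w; split=> // v /wlt.
Qed.

(** A permutation can be read off from its effect on the minimal points with singleton labels. *)
Lemma act_faithful s t : act s =1 act t -> s = t.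
Proof.
move=> st; apply/permP => i; have [w [wval _]] := minimal_exists [set i]%SET.
have := congr1 (fun w => Kval w) (st w).
by rewrite /= !Kval_act wval !imset_set1 => /set1_inj.
Qed.

End Action.

(** * Order automorphisms of K_n come from permutations of the symbols *)

Section OrderAutomorphisms.
Context {n : nat}.
Implicit Types (s t : {perm 'I_n}) (u v w x : K n).

Local Open Scope classical_set_scope.

Definition covers (Z : set (K n)) u := forall v, Klt v u <-> Z v.

Lemma Kle_covers_exists w (b : {set 'I_n}) : b \proper Kval w ->
  exists u, Kval u = b /\ covers [set v | Kle v w] u.
Proof.
move=> bw; apply: K_exists; first exact: finite_Kle.
- by move=> x y xy; exact: Kle_trans.
- by move=> v /Kval_anti; apply: fintype.subset_trans; exact: proper_sub.
- move=> x xw bx; have wx : w = x.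
    by apply: Kle_anti; [apply/xw|apply/xw]; exact: Kle_refl.
  by move: bw; rewrite wx bx fintype.properxx.
Qed.

Lemma covers_Kle_proper w u : covers [set v | Kle v w] u -> Kval u \proper Kval w.
Proof.
move=> uw; have wu : Klt w u by apply/uw; exact: Kle_refl.
rewrite finset.properEneq Kval_anti ?andbT; last exact: KltW.
by apply/eqP; exact: Kval_neq.
Qed.

Lemma Kval0P w : Kval w = finset.set0 <-> ~ exists u, covers [set v | Kle v w] u.
Proof.
split=> [w0 [u /covers_Kle_proper/proper_card]|nu]; first by rewrite w0 cards0.
apply/eqP; apply: contra_notT nu; rewrite -proper0 => /Kle_covers_exists[u [_ uw]].
by exists u.
Qed.

(** By [K_ext] a cover is determined by its label, and the labels available are the proper subsets
    of [Kval w]; a set has exactly one proper subset iff it is a singleton. *)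
Lemma Kval1P w : (exists i, Kval w = [set i]%SET) <->
  exists u, covers [set v | Kle v w] u /\
    forall u', covers [set v | Kle v w] u' -> u' = u.
Proof.
split=> [[i wi]|[u [uw uuniq]]].
- have [|u [u0 uw]] := @Kle_covers_exists w finset.set0.
    by rewrite proper0 wi; apply/set0Pn; exists i; rewrite inE.
  exists u; split=> // u' u'w; apply: K_ext => [|v]; last by rewrite uw u'w.
  have := covers_Kle_proper u'w; rewrite wi properEcard finset.subset1 cards1.
  by case/andP => /orP[/eqP ->|/eqP ->]; rewrite ?cards1.
- have w0 : finset.set0 \proper Kval w.
    exact: fintype.sub_proper_trans (finset.sub0set _) (covers_Kle_proper uw).
  have /set0Pn[i iw] : Kval w != finset.set0 by rewrite -proper0.
  exists i; apply/eqP; rewrite finset.eqEsubset finset.sub1set iw andbT.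
  apply: contraT => nwi.
  have [u0 [u0v u0w]] := Kle_covers_exists w0.
  have [|u1 [u1v u1w]] := @Kle_covers_exists w [set i]%SET.
    by rewrite fintype.properE finset.sub1set iw.
  have := uuniq _ u1w; rewrite -(uuniq _ u0w) => u10.
  have := u1v; rewrite u10 u0v => /setP/(_ i); by rewrite !inE eqxx.
Qed.

Lemma mem_KvalP i w u0 : (forall v, ~ Klt v u0) -> Kval u0 = [set i]%SET ->
  ~ Kle u0 w -> i \in Kval w <->
  exists u u', [/\ u <> u', covers [set v | Kle v w \/ v = u0] u &
    covers [set v | Kle v w \/ v = u0] u'].
Proof.
move=> u0min u0i nu0w.
have ex (b : {set 'I_n}) : b \subset Kval w -> b \subset [set i]%SET ->
    exists u, Kval u = b /\ covers [set v | Kle v w \/ v = u0] u.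
  move=> bw bi; apply: K_exists.
  - rewrite (_ : [set v | _] = [set v | Kle v w] `|` [set u0]) // finite_setU.
    by split; [exact: finite_Kle|exact: finite_set1].
  - move=> x y xy [yw|yu]; first by left; exact: Kle_trans xy yw.
    by move: xy; rewrite yu => /KleE[/u0min//|]; right.
  - move=> v [/Kval_anti|->]; last by rewrite u0i.
    exact: fintype.subset_trans.
  (* The set is not principal, so (iii) is vacuous: a generator below [w] would put [u0] below [w],
     and a generator equal to [u0] would give [w = u0] by minimality. *)
  - move=> x xP _; have [xw|xu0] : Kle x w \/ x = u0 by apply/xP; exact: Kle_refl.
      by apply: nu0w; apply: Kle_trans xw; apply/xP; right.
    have : Kle w u0 by rewrite -xu0; apply/xP; left; exact: Kle_refl.
    by move=> /KleE[/u0min//|wu]; apply: nu0w; rewrite wu; exact: Kle_refl.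
split=> [iw|[u [u' [uu' uc u'c]]]].
- have [|//|u [uv uc]] := ex finset.set0; rewrite ?finset.sub0set//.
  have [||u' [u'v u'c]] := ex [set i]%SET; rewrite ?finset.sub1set ?inE//.
  exists u, u'; split=> // uu'; have := u'v; rewrite -uu' uv => /setP/(_ i).
  by rewrite !inE eqxx.
(* If [i] is not in [Kval w], every cover has the empty label, so any two covers coincide. *)
- apply: contra_notT uu' => iw.
  have val0 x : covers [set v | Kle v w \/ v = u0] x -> Kval x = finset.set0.
    move=> xc; apply/eqP; rewrite -finset.subset0; apply/fintype.subsetP => j jx.
    have ji : j \in [set i]%SET.
      rewrite -u0i; apply: (fintype.subsetP (Kval_anti _)) jx.
      by apply: KltW; apply/xc; right.
    have jw : j \in Kval w.
      apply: (fintype.subsetP (Kval_anti _)) jx.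
      by apply: KltW; apply/xc; left; exact: Kle_refl.
    by move: jw iw; rewrite (set1P ji) => ->.
  by apply: K_ext => [|v]; [rewrite !val0|rewrite uc u'c].
Qed.

Section Phi.
Context {phi psi : K n -> K n} (phiK : cancel phi psi) (psiK : cancel psi phi).
Context (Kle_phi : forall v w, Kle (phi v) (phi w) <-> Kle v w).

Lemma Klt_phi v w : Klt (phi v) (phi w) <-> Klt v w.
Proof.
rewrite !Klt_neqle Kle_phi; split=> -[vw le]; split=> //.
- by move=> E; apply: vw; rewrite E.
- by move=> /(can_inj phiK).
Qed.

Lemma Klt_psi v w : Klt v (phi w) <-> Klt (psi v) w.
Proof. by rewrite -(Klt_phi (psi v)) psiK. Qed.

Lemma covers_phi (Z : set (K n)) u : covers Z (phi u) <-> covers (phi @^-1` Z) u.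
Proof.
split=> uZ v; first by rewrite -Klt_phi uZ.
by rewrite Klt_psi uZ /= psiK.
Qed.

Lemma preimage_phi_Kle w :
  phi @^-1` [set v | Kle v (phi w)] = [set v | Kle v w].
Proof. by apply/seteqP; split=> v /= /Kle_phi. Qed.

Lemma covers_Kle_phi w u :
  covers [set v | Kle v (phi w)] (phi u) <-> covers [set v | Kle v w] u.
Proof. by rewrite covers_phi preimage_phi_Kle. Qed.

Lemma Kval0_phi w : Kval (phi w) = finset.set0 <-> Kval w = finset.set0.
Proof.
rewrite !Kval0P; split=> nu [u uw]; apply: nu.
  by exists (phi u); apply/covers_Kle_phi.
by exists (psi u); apply/covers_Kle_phi; rewrite psiK.
Qed.

Lemma Kval1_phi w : (exists i, Kval w = [set i]%SET) ->
  exists i, Kval (phi w) = [set i]%SET.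
Proof.
move=> /Kval1P[u [uw uuniq]]; apply/Kval1P; exists (phi u); split.
  exact/covers_Kle_phi.
move=> u'; rewrite -(psiK u') => /covers_Kle_phi/uuniq -> //.
Qed.

Lemma order_aut_perm : exists s, forall w, Kval (phi w) = s @: Kval w.
Proof.
(* [a i] is the minimal point labelled by {i}; the label of its image defines the permutation
   [f]. *)
have /choice[a aP] (i : 'I_n) := minimal_exists [set i]%SET.
have /choice[f fP] (i : 'I_n) : exists j, Kval (phi (a i)) = [set j]%SET.
  by apply: Kval1_phi; exists i; have [] := aP i.
have fmin i v : ~ Klt v (phi (a i)).
  by rewrite Klt_psi; have [_] := aP i; apply.
have finj : injective f.
  move=> i j ij; have : phi (a i) = phi (a j).
    by apply: K_ext => [|v]; [rewrite !fP ij|split=> /fmin].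
  move=> /(can_inj phiK) aij; apply: set1_inj.
  by have [<- _] := aP i; have [<- _] := aP j; rewrite aij.
exists (perm finj) => w.
suff mem i : i \in Kval w <-> f i \in Kval (phi w).
  apply/setP => j; rewrite -(f_invF finj j); set i := invF finj j.
  rewrite -[f i in RHS](permE finj) (mem_imset _ _ perm_inj).
  by apply/idP/idP => /mem.
have [ai amin] := aP i.
(* If [a i] lies below [w], then [Kval w] is contained in {i}, so membership of [i] amounts to
   non-emptiness, which [Kval0_phi] transports. *)
have [aw|naw] := EM (Kle (a i) w).
  have sub0 (b : {set 'I_n}) k : b \subset [set k]%SET ->
      k \in b <-> b <> finset.set0.
    rewrite finset.subset1 => /orP[] /eqP ->; rewrite inE ?eqxx; split=> //.
    by move=> _ /setP/(_ k); rewrite !inE eqxx.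
  rewrite (sub0 (Kval w)); last by rewrite -ai; exact: Kval_anti.
  rewrite (sub0 (Kval (phi w))) ?Kval0_phi // -fP.
  by apply: Kval_anti; exact/Kle_phi.
have nfaw : ~ Kle (phi (a i)) (phi w) by rewrite Kle_phi.
rewrite (mem_KvalP amin ai naw) (mem_KvalP (fmin i) (fP i) nfaw).
have Zphi : phi @^-1` [set v | Kle v (phi w) \/ v = phi (a i)] =
    [set v | Kle v w \/ v = a i].
  apply/seteqP; split=> v /= [vw|vw].
  - by left; apply/Kle_phi.
  - by right; apply: (can_inj phiK).
  - by left; apply/Kle_phi.
  - by right; rewrite vw.
split=> -[u [u' [uu' uc u'c]]].
  exists (phi u), (phi u'); split; [|by apply/covers_phi; rewrite Zphi..].
  by move=> /(can_inj phiK).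
exists (psi u), (psi u'); split; [|by rewrite -Zphi; apply/covers_phi; rewrite psiK..].
by move=> /(can_inj psiK).
Qed.

Lemma order_aut_act : exists s, phi =1 act s.
Proof.
have [s sP] := order_aut_perm; exists s.
elim/(well_founded_ind (@Klt_wf n)) => w IH; apply: K_ext => [|v].
  by rewrite sP Kval_act.
rewrite Klt_actP Klt_psi; split=> [vw|[u uw ->]].
  by exists (psi v) => //; rewrite -IH // psiK.
by rewrite -IH // phiK.
Qed.

End Phi.
End OrderAutomorphisms.

(** * Heyting automorphisms as order automorphisms *)

Section HeytingAutomorphisms.
Context {d : Order.disp_t} {A : heytingType d}.
Implicit Types (f : hAut A) (x y : A).

Lemma haut_le f x y : (f x <= f y)%O = (x <= y)%O.
Proof.
rewrite !leEmeet -(hmorphI (haut_morph f)).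
by rewrite (inj_eq (bij_inj (haut_bij f))).
Qed.

Lemma hautK f : cancel f (f^-1)%g.
Proof. by move=> x; have := congr1 (fun g : hAut A => g x) (mulVg f). Qed.

Lemma hautVK f : cancel (f^-1)%g f.
Proof. by move=> x; have := congr1 (fun g : hAut A => g x) (mulgV f). Qed.

(** The order determines the Heyting operations; [le_fg] and [le_gf] move [f] across an inequality,
    which reduces each clause to a universal property. *)
Lemma order_iso_hmorph (f g : A -> A) : cancel f g -> cancel g f ->
  {mono f : x y / (x <= y)%O} -> is_hmorph f.
Proof.
move=> fK gK le_f; have le_fg x y : (f x <= y)%O = (x <= g y)%O.
  by rewrite -[RHS]le_f gK.
have le_gf x y : (x <= f y)%O = (g x <= y)%O by rewrite -[RHS]le_f gK.
split=> [||x y|x y|x y].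
- by apply/eqP; rewrite -lex0 le_fg le0x.
- by apply/eqP; rewrite -le1x le_gf lex1.
- by apply: le_anti; rewrite lexI !le_f leIl leIr le_gf lexI -!le_gf leIl leIr.
- by apply: le_anti; rewrite leUx !le_f leUl leUr le_fg leUx -!le_fg leUl leUr.
- have fI a b : f (a `&` b)%O = (f a `&` f b)%O.
    by apply: le_anti; rewrite lexI !le_f leIl leIr le_gf lexI -!le_gf leIl leIr.
  apply: le_anti; apply/andP; split; first by rewrite lehimp -fI le_f -lehimp.
  by rewrite le_gf lehimp -le_f fI gK -lehimp.
Qed.

End HeytingAutomorphisms.

(** Invariance as an equality, not just an inclusion, lets the inverse restrict too. *)
Lemma haut_restrict d (A : heytingType d) (H : subHeyting A) (f : hAut A) :
  (f @` H)%classic = H ->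
  exists g : hAut (sh_type H), forall x : sh_type H, val (g x) = f (val x).
Proof.
move=> fH; have fP (x : sh_type H) : f (val x) \in sh_set H.
  apply/mem_set; have : (f @` H)%classic (f (val x)).
    by exists (val x) => //; exact: set_mem (valP x).
  by rewrite {1}fH.
have fVP (x : sh_type H) : (f^-1)%g (val x) \in sh_set H.
  have [y Hy <-] : (f @` H)%classic (val x).
    by have := set_mem (valP x); rewrite -{1}fH.
  by rewrite hautK; exact/mem_set.
pose g (x : sh_type H) : sh_type H := exist _ (f (val x)) (fP x).
pose gV (x : sh_type H) : sh_type H := exist _ (f^-1%g (val x)) (fVP x).
have gK : cancel g gV by move=> x; apply: val_inj; exact: hautK.
have gVK : cancel gV g by move=> x; apply: val_inj; exact: hautVK.
have le_g : {mono g : x y / (x <= y :> sh_type H)%O}.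
  by move=> x y; rewrite !sh_leE haut_le.
by exists (@HAut _ (sh_type H) g (Bijective gK gVK) (order_iso_hmorph gK gVK le_g)).
Qed.

(** * Automorphisms of algebras containing all finite decreasing sets *)

Section Representation.
Context {n : nat} {d : Order.disp_t} {A : heytingType d}.
(** An abstract embedding lets one argument serve both a dense subalgebra, through [val], and
    [Fhat n] itself, through [id]. *)
Context {iota : A -> Fhat n} (iota_le : {mono iota : x y / (x <= y)%O}).
Context (iota_finite : forall a : Fhat n,
  finite_set (val a) -> exists x, iota x = a).
Implicit Types (f g : hAut A) (x y : A) (s t : {perm 'I_n}) (v w : K n).

Local Open Scope classical_set_scope.

Lemma iota_subset x y : (x <= y)%O <-> val (iota x) `<=` val (iota y).
Proof.
by rewrite -iota_le Fhat_leE; split=> [/subsetPset|h]; last exact/subsetPset.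
Qed.

Lemma principal_leP (a : Fhat n) w : val a w <-> val (principal w) `<=` val a.
Proof.
split=> [aw v vw|h]; last by apply: h; exact: Kle_refl.
exact: (set_mem (valP a)) vw aw.
Qed.

Definition below w : Fhat n := MkFhat (fun u v uv (vw : Klt v w) => Kle_lt_trans uv vw).

Definition tracks f s :=
  forall x w, val (iota (f x)) (act s w) <-> val (iota x) w.

Lemma tracks_exists f : exists s, tracks f s.
Proof.
have /choice[p pE] w : exists x, iota x = principal w.
  by apply: iota_finite; exact: finite_Kle.
have /choice[q qE] w : exists x, iota x = below w.
  by apply: iota_finite; exact: finite_Klt.
have in_p x w : val (iota x) w <-> (p w <= x)%O.
  by rewrite iota_subset pE principal_leP.
have le_p v w : Kle v w <-> (p v <= p w)%O by rewrite -in_p pE.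
have inj_p : injective p.
  by move=> v w vw; apply: Kle_anti; apply/le_p; rewrite vw.
(* [below w] is the largest decreasing set properly inside [principal w]. A point [w'] of [g (p w)]
   outside [g (q w)] makes the preimage of [p w'] lie below [p w] but not below [q w]; that preimage
   is then [p w]. *)
have aut_p g w : exists w', g (p w) = p w'.
  have [w' [w'p w'q]] : exists w', val (iota (g (p w))) w' /\ ~ val (iota (g (q w))) w'.
    apply: contrapT => nex; have : (g (p w) <= g (q w))%O.
      by apply/iota_subset => v vp; apply: contrapT => vq; apply: nex; exists v.
    by rewrite haut_le -in_p qE; exact: Klt_irr.
  exists w'; apply: le_anti; apply/andP; split; last exact/in_p.
  apply: contrapT => /negP npw; apply: w'q; apply/in_p.
  rewrite -(hautVK g (p w')) haut_le; apply/iota_subset => v vz.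
  rewrite qE; apply/Klt_neqle; split=> [vw|].
    move: npw; rewrite -(hautVK g (p w')) haut_le => /negP; apply.
    by apply/in_p; rewrite -vw.
  have : (g^-1%g (p w') <= p w)%O by rewrite -(haut_le g) hautVK; exact/in_p.
  by move=> /iota_subset/(_ v vz); rewrite pE.
have /choice[phi phiE] := aut_p f.
have /choice[psi psiE] := aut_p (f^-1)%g.
have phiK : cancel phi psi.
  by move=> w; apply: inj_p; rewrite -psiE -phiE hautK.
have psiK : cancel psi phi.
  by move=> w; apply: inj_p; rewrite -phiE -psiE hautVK.
have [|s phis] := order_aut_act phiK psiK.
  by move=> v w; rewrite !le_p -!phiE haut_le.
exists s => x w; by rewrite -phis !in_p -phiE haut_le.
Qed.

Lemma tracks_inj f s t : tracks f s -> tracks f t -> s = t.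
Proof.
move=> fs ft; apply: act_faithful => w.
have [x xE] : exists x, iota x = principal w.
  by apply: iota_finite; exact: finite_Kle.
have le s' t' : tracks f s' -> tracks f t' -> Kle (act s' w) (act t' w).
  move=> fs' ft'; have : val (iota (f x)) (act s' w).
    by apply/fs'; rewrite xE; exact: Kle_refl.
  by rewrite -{1}(actKV t' (act s' w)) ft' xE /= -(Kle_act t') actKV.
by apply: Kle_anti; exact: le.
Qed.

Lemma tracks_eq f g s : tracks f s -> tracks g s -> f = g.
Proof.
move=> fs gs; apply: haut_ext => x.
by apply: le_anti; apply/andP; split; apply/iota_subset => w;
  rewrite -(actKV s w) fs gs.
Qed.

Lemma tracksM f g s t : tracks f s -> tracks g t -> tracks (f * g)%g (t * s)%g.
Proof. by move=> fs gt x w; rewrite -actM /= fs gt. Qed.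

(** Products in [hAut A] and in the permutation group compose in opposite orders, so tracking is an
    antihomomorphism by [tracksM]; passing to the inverse permutation repairs this. *)
Lemma haut_perm_embedding : exists F : {multiplicative hAut A -> {perm 'I_n}},
  injective F /\ forall f s, tracks f s -> F f = (s^-1)%g.
Proof.
have /choice[T TP] := tracks_exists.
have FM : {morph (fun f => (T f)^-1)%g : f g / (f * g)%g >-> (f * g)%g}.
  move=> f g /=; rewrite -invMg; congr (_^-1)%g.
  exact: tracks_inj (TP _) (tracksM (TP f) (TP g)).
pose F := isMultiplicative.Build _ _ _ FM.
pose F' : {multiplicative hAut A -> {perm 'I_n}} := HB.pack (fun f => (T f)^-1)%g F.
exists F'; split=> [f g /invg_inj fg|f s fs].
  by apply: (tracks_eq (TP f)); rewrite fg; exact: TP.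
by congr (_^-1)%g; exact: tracks_inj (TP f) fs.
Qed.

Lemma haut_isog_perm_subgroup : isog_perm_subgroup (hAut A) n.
Proof.
have [F [Finj _]] := haut_perm_embedding.
pose S := [set s | `[< range F s >]]%SET.
have SP s : s \in S <-> range F s by rewrite inE; split=> /asboolP.
have gS : group_set S.
  apply/group_setP; split=> [|s t /SP[f _ <-] /SP[g _ <-]].
    apply/SP; exists 1%g => //.
    by apply: (mulgI (F 1%g)); rewrite -gmulfM !mulg1.
  by apply/SP; exists (f * g)%g => //; rewrite gmulfM.
exists (Group gS), F; split=> //; apply/seteqP; split=> s; first by move/SP.
by move/SP.
Qed.

Lemma haut_isog_Sym : (forall s, exists f, tracks f s) -> isog_Sym (hAut A) n.
Proof.
move=> surj; have [F [Finj FP]] := haut_perm_embedding; exists F.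
have /choice[G GP] s : exists f, F f = s.
  by have [f /FP fs] := surj (s^-1)%g; exists f; rewrite fs invgK.
by exists G => // f; apply: Finj; rewrite GP.
Qed.

End Representation.

(** * Density amounts to containing all finite decreasing sets *)

Section Density.
Context {R : realType} {n : nat}.
Implicit Types (a h : Fhat n) (H : set (Fhat n)) (w : K n).

Local Open Scope classical_set_scope.

Lemma Klevel_le i j : (i <= j)%N -> Klevel (n := n) i `<=` Klevel j.
Proof. by move=> ij w; apply: stage_le. Qed.

Lemma finite_Klevel_bounded (Y : set (K n)) : finite_set Y ->
  exists i, Y `<=` Klevel i.
Proof.
move=> finY; have /finite_fsetP[X XE] : finite_set ((fun v : K n => val v) @` Y).
  exact: finite_image.
have [x xX|k kX] := @stage_bounded n X.
  have : [set` X] x by []; rewrite -XE => -[v _ <-]; exact: K_in_stage.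
exists k => v Yv; apply: (stage_le (leqnSn k)); apply: kX.
by rewrite -XE; exists v.
Qed.

(** Levels increase, so agreement on one passes to all lower ones; the first disagreement thus comes
    after [i] iff there is agreement at [i]. *)
Lemma Fdist_ltP a h i : (Fdist R a h < 2 ^- i)%R <->
  val a `&` Klevel i = val h `&` Klevel i.
Proof.
have e20 k : (0 < 2 ^- k :> R)%R by rewrite invr_gt0 exprn_gt0.
have ltV k m : (2 ^- k < 2 ^- m :> R)%R = (m < k)%N.
  by rewrite ltf_pV2 ?posrE ?exprn_gt0 // ltr_eXn2l // ltr1n.
rewrite /Fdist; case: pselect => [ex|nex]; last first.
  split=> // _; apply: contrapT => ahi; apply: nex.
  by exists i; apply/asboolP.
case: ex_minnP => m /asboolP ahm m_min; rewrite ltV; split=> [im|ahi].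
  apply: contrapT => ahi; have /m_min : differ a h i by apply/asboolP.
  by rewrite leqNgt im.
rewrite ltnNge; apply/negP => mi; apply: ahm.
have KI : Klevel i `&` Klevel m = Klevel (n := n) m.
  by apply/seteqP; split=> [w []//|w mw]; split=> //; exact: Klevel_le mi _ mw.
by rewrite -KI !setIA ahi.
Qed.

(* A finite decreasing set [a], contained in K^i, is isolated: a decreasing set
   that agrees with [a] on K^(i+1) has no point of level i+1 exactly, hence no
   point of a higher level. *)
Lemma dense_finite H : metric_dense R H -> forall a, finite_set (val a) -> H a.
Proof.
move=> Hdense a /finite_Klevel_bounded[i ai].
have [|h Hh /Fdist_ltP ahi] := Hdense a (2 ^- i.+1)%R.
  by rewrite invr_gt0 exprn_gt0.
suff hi : val h `<=` Klevel i.
  suff -> : a = h by [].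
  apply: val_inj; have le_i : Klevel i `<=` Klevel (n := n) i.+1 by exact: Klevel_le.
  have /setIidPl <- := subset_trans ai le_i.
  by rewrite ahi; apply/setIidPl; exact: subset_trans hi le_i.
move=> w hw; apply: contrapT => iw.
have [v [vw [hv iv] vmin]] :=
  @K_minimal n [set w | val h w /\ ~ Klevel i w] w (conj hw iw).
apply: iv; apply: ai.
suff : (val h `&` Klevel i.+1) v by rewrite -ahi => -[].
split=> //; apply: Klevel_low => u uv; apply: contrapT => iu; apply: (vmin u uv).
by split=> //; exact: (set_mem (valP h)) (KltW uv) hv.
Qed.

(** The truncations of [a] to the levels are finite, decreasing and converge to [a]. *)
Lemma finite_dense H :
  (forall a, finite_set (val a) -> H a) -> metric_dense R H.
Proof.
(* By [upper_nthrootP] this exponent satisfies 1/e < 2^i. *)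
move=> Hfin a e e0; pose i := Num.bound (e^-1)%R.
have ie : (2 ^- i < e)%R.
  rewrite -[ltRHS]invrK ltf_pV2 ?posrE ?invr_gt0 ?exprn_gt0 //.
  exact: upper_nthrootP.
have trunc_dec : decreasing (val a `&` Klevel i).
  move=> v w vw [aw iw]; split; first exact: (set_mem (valP a)) vw aw.
  by move: vw => /KleE[/(stage_low iw)|->].
exists (MkFhat trunc_dec).
  by apply: Hfin; apply: sub_finite_set (finite_Klevel i) => w [].
by apply: lt_trans ie; apply/Fdist_ltP; rewrite /= -setIA setIid.
Qed.

End Density.

(** * Automorphisms of the full algebra induced by permutations *)

Section PermAutomorphisms.
Context {n : nat}.
Implicit Types (a : Fhat n) (w : K n) (s : {perm 'I_n}).

Local Open Scope classical_set_scope.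

Lemma act_preimage_decreasing s a : decreasing (act s @^-1` (val a)).
Proof. by move=> v w vw; apply: (set_mem (valP a)); apply/Kle_act. Qed.

Definition Fact s a : Fhat n := MkFhat (@act_preimage_decreasing s a).

Lemma FactK s : cancel (Fact s) (Fact s^-1%g).
Proof. by move=> a; apply: val_inj; apply/funext => w /=; rewrite /preimage /= actKV. Qed.

Lemma FactVK s : cancel (Fact s^-1%g) (Fact s).
Proof. by move=> a; apply: val_inj; apply/funext => w /=; rewrite /preimage /= actK. Qed.

Lemma le_Fact s : {mono Fact s : a b / (a <= b)%O}.
Proof.
have homo t : {homo Fact t : a b / (a <= b)%O}.
  move=> a b; rewrite !Fhat_leE => /subsetPset ab; apply/subsetPset => w.
  exact: ab.
move=> a b; apply/idP/idP => [/(homo s^-1%g)|/homo//].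
by rewrite !FactK.
Qed.

(** The underlying map is [Fact s^-1], the preimage along the inverse, hence the direct image along
    [act s], as [tracks] requires. *)
Definition hact s : hAut (Fhat n) :=
  HAut (Bijective (FactVK s) (FactK s))
    (order_iso_hmorph (FactVK s) (FactK s) (@le_Fact s^-1%g)).

Lemma hactP s a w : val (hact s a) (act s w) <-> val a w.
Proof. by rewrite /= /preimage /= actK. Qed.

Lemma haut_principal (f : hAut (Fhat n)) w : exists v, f (principal w) = principal v.
Proof.
have [|s fs] := @tracks_exists n _ (Fhat n) id (fun _ _ => erefl) _ f.
  by move=> a _; exists a.
exists (act s w); apply: val_inj; apply/seteqP; split=> v /=.
  by rewrite -(actKV s v) fs Kle_act.
by rewrite -(actKV s v) fs Kle_act.
Qed.

End PermAutomorphisms.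

(** * Principal sets as Heyting terms in the generators *)

Section Bellissima.
Context {n : nat} {L : subHeyting (Fhat n)}.
Implicit Types (a b : Fhat n) (u v w : K n).

Local Open Scope classical_set_scope.

(** The Kripke clause for implication; the down-set of [w] witnesses the converse. *)
Lemma himpE a b w : val (himp a b) w <->
  forall u, Kle u w -> val a u -> val b u.
Proof.
split=> [[c [cdec cab] cw] u uw au|h].
  by case: (cab u) => //; exact: cdec uw cw.
exists [set v | Kle v w]; last exact: Kle_refl.
split; first by move=> x y xy; exact: Kle_trans.
move=> u uw; have [au|nau] := EM (val a u); last by left.
by right; exact: h.
Qed.

Lemma sh_meet_finite (I : choiceType) (D : set I) (F : I -> Fhat n) :
  finite_set D -> (forall i, D i -> sh_set L (F i)) ->
  exists2 x, sh_set L x & forall w, val x w <-> forall i, D i -> val (F i) w.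
Proof.
move=> /finite_seqP[r ->]; elim: r => [|i r IH] LF.
  by exists \top%O; [exact: shc1 (sh_closed L)|].
have [|x Lx xP] := IH; first by move=> j jr; apply: LF; rewrite /= inE jr orbT.
exists (F i `&` x)%O.
  by apply: (shcI (sh_closed L)) => //; apply: LF; rewrite /= inE eqxx.
move=> w; rewrite Fhat_valI; split=> [[iw /xP xw] j /=|h].
  by rewrite inE => /orP[/eqP -> //|]; exact: xw.
split; first by apply: h; rewrite /= inE eqxx.
by apply/xP => j jr; apply: h; rewrite /= inE jr orbT.
Qed.

Lemma sh_join_finite (I : choiceType) (D : set I) (F : I -> Fhat n) :
  finite_set D -> (forall i, D i -> sh_set L (F i)) ->
  exists2 x, sh_set L x & forall w, val x w <-> exists2 i, D i & val (F i) w.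
Proof.
move=> /finite_seqP[r ->]; elim: r => [|i r IH] LF.
  by exists \bot%O; [exact: shc0 (sh_closed L)|move=> w; split=> [[]|[]]].
have [|x Lx xP] := IH; first by move=> j jr; apply: LF; rewrite /= inE jr orbT.
exists (F i `|` x)%O.
  by apply: (shcU (sh_closed L)) => //; apply: LF; rewrite /= inE eqxx.
move=> w; rewrite Fhat_valU; split=> [[iw|/xP[j jr jw]]|[j]].
- by exists i => //=; rewrite inE eqxx.
- by exists j => //=; rewrite inE jr orbT.
- rewrite /= inE => /orP[/eqP -> //|jr jw]; first by left.
  by right; apply/xP; exists j.
Qed.

Lemma sh_finite a : finite_set (val a) ->
  (forall w, val a w -> sh_set L (principal w)) -> sh_set L a.
Proof.
move=> fina La; have [x Lx xP] := sh_join_finite fina La.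
suff -> : a = x by []; apply: val_inj; apply/seteqP; split=> w.
  by move=> aw; apply/xP; exists w => //; exact: Kle_refl.
by move=> /xP[v av wv]; exact: (set_mem (valP a)) wv av.
Qed.

(* De Jongh's description of [w]: read with [Fgen i] for "i is in the label" and
   with [below] for the points strictly below, it is a Heyting term. *)
Lemma Kle_char w u : Kle u w <-> Kval w \subset Kval u /\
  forall x, Kle x u -> ~ Klt x w ->
    Kval x \subset Kval w /\ forall v, Klt v w -> Kle v x.
Proof.
split=> [uw|[valu hu]].
  split=> [|x xu xw]; first exact: Kval_anti.
  have /KleE[//|->] := Kle_trans xu uw; split=> // v; exact: KltW.
have [uw|nuw] := EM (Klt u w); first exact: KltW.
(* Points of [B] carry the label of [w] and lie above everything strictly below [w]. A minimal point
   of [B] has nothing else below it, so it is [w] by [K_ext]; hence [B] lies above [w]. *)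
pose B := [set x | Kle x u /\ ~ Klt x w].
have Bval x : B x -> Kval x = Kval w.
  move=> [xu xw]; have [xw' _] := hu x xu xw; apply/eqP.
  rewrite finset.eqEsubset xw' /=; apply: fintype.subset_trans valu _.
  exact: Kval_anti.
have Blt x v : B x -> Klt v w -> Klt v x.
  move=> [xu xw] vw; apply/Klt_neqle; split; first by move=> vx; rewrite -vx in xw.
  by have [_] := hu x xu xw; apply.
have Bw x : B x -> Kle w x.
  move=> Bx; have [y [yx By ymin]] := K_minimal Bx.
  suff -> : w = y by [].
  apply: K_ext => [|v]; first by rewrite Bval.
  split=> [|vy]; first exact: Blt.
  apply: contrapT => vw; apply: (ymin v vy); split=> //.
  by have [yu _] := By; exact: Kle_trans (KltW vy) yu.
have Bu : B u by split=> //; exact: Kle_refl.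
apply: contrapT => uw; have uneq : u <> w.
  by move=> E; apply: uw; rewrite E; exact: Kle_refl.
(* A minimal point of [B] other than [w] would cover the down-set of [w] with the same label,
   against [Kval_neq]. *)
have [y [yu [By yw] ymin]] := @K_minimal n [set x | B x /\ x <> w] u (conj Bu uneq).
apply: (@Kval_neq n y w); last exact: Bval.
have wy : Klt w y by apply/Klt_neqle; split; [exact/nesym|exact: Bw].
move=> v; split=> [vy|vw]; last exact: Kle_lt_trans vw wy.
apply: contrapT => vw; apply: (ymin v vy); split.
  split; first exact: Kle_trans (KltW vy) yu.
  by move=> /KltW.
by move=> E; apply: vw; rewrite E; exact: Kle_refl.
Qed.

Lemma sh_principal w : (forall i, sh_set L (Fgen i)) -> sh_set L (principal w).
Proof.
move=> Lgen; elim/(well_founded_ind (@Klt_wf n)): w => w IH.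
have Lbelow v : Kle v w -> sh_set L (below v).
  move=> vw; apply: sh_finite; first exact: finite_Klt.
  by move=> u uv; apply: IH; exact: Klt_le_trans uv vw.
have Limp := shc_imp (sh_closed L).
have finI (D : set 'I_n) : finite_set D by exact: finite_finset.
(* The three conjuncts of the de Jongh term: [x] gives the label inclusion, while [y] and [z] bound
   the labels and the lower sets of the points not strictly below [w]. *)
have [x Lx xP] := @sh_meet_finite _ [set i | i \in Kval w] _ (finI _) (fun i _ => Lgen i).
have [|y Ly yP] := @sh_meet_finite _ [set i | i \notin Kval w]
  (fun i => himp (Fgen i) (below w)) (finI _).
  by move=> i _; apply: (Limp); [exact: Lgen | apply: Lbelow; exact: Kle_refl].
have [|z Lz zP] := @sh_meet_finite _ [set v | Klt v w]
  (fun v => himp (himp (principal v) (below v)) (below w)) (finite_Klt w).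
  move=> v vw; apply: (Limp); last by apply: Lbelow; exact: Kle_refl.
  by apply: (Limp); [exact: IH|apply: Lbelow; exact: KltW].
(* This implication is the largest decreasing set avoiding [v], so it expresses that [v] is not
   below a point. *)
have psiP v u : val (himp (principal v) (below v)) u <-> ~ Kle v u.
  rewrite himpE; split=> [h vu|vu u' u'u u'v].
    exact: (Klt_irr (h v vu (Kle_refl v))).
  by apply/Klt_neqle; split=> // E; apply: vu; rewrite -E.
suff -> : principal w = (x `&` (y `&` z))%O.
  by apply: (shcI (sh_closed L)) => //; exact: (shcI (sh_closed L)).
apply: val_inj; rewrite !Fhat_valI; apply/seteqP; split=> u.
- move=> /Kle_char[wu hu]; split; last split.
  + by apply/xP => i iw; exact: (fintype.subsetP wu).
  + apply/yP => i iw; apply/himpE => v vu iv; apply: contrapT => vw.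
    by have [/fintype.subsetP/(_ i iv) ivw] := hu v vu vw; rewrite /= ivw in iw.
  + apply/zP => v vw; apply/himpE => t tu /psiP vt; apply: contrapT => tw.
    by apply: vt; have [_] := hu t tu tw; apply.
- move=> [/xP xu [/yP yu /zP zu]]; apply/Kle_char; split.
    by apply/fintype.subsetP => i /xu.
  move=> t tu tw; split.
    apply/fintype.subsetP => i it; apply: contraT => iw.
    by have /himpE/(_ t tu it) := yu i iw.
  move=> v vw; apply: contrapT => vt.
  by have /himpE/(_ t tu) := zu v vw; move=> /(_ (iffRL (psiP v t) vt)).
Qed.

End Bellissima.

(** * Density and invariance of the algebra generated by the principal sets *)

Lemma sub_sh_gen d (A : heytingType d) (S : set A) : (S `<=` sh_gen S)%classic.
Proof. by move=> x Sx H /(_ x Sx). Qed.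

Section Breve.
Context {n : nat}.
Implicit Types (w : K n) (a : Fhat n).

Local Open Scope classical_set_scope.

Lemma Ffree_principal w : sh_set (Ffree n) (principal w).
Proof. by apply: sh_principal => i; apply: sub_sh_gen; exists i. Qed.

Lemma Fbreve_principal w : sh_set (Fbreve n) (principal w).
Proof.
exists (exist _ (principal w) (mem_set (Ffree_principal w))) => //.
by apply: sub_sh_gen; exists w.
Qed.

Lemma Fbreve_finite a : finite_set (val a) -> sh_set (Fbreve n) a.
Proof. by move=> fina; apply: sh_finite => // w _; exact: Fbreve_principal. Qed.

Lemma Fbreve_haut (f : hAut (Fhat n)) a : sh_set (Fbreve n) a -> sh_set (Fbreve n) (f a).
Proof.
have [f0 f1 fI fU fi] := haut_morph f.
have [B0 B1 BI BU Bi] := sh_closed (Fbreve n).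
(* The preimage of [Fbreve n] under [f] is a subalgebra of F_n containing the generators; arguing
   with it avoids asking whether [f] preserves F_n. *)
have closed : subheyting_closed
    [set x : sh_type (Ffree n) | sh_set (Fbreve n) (f (val x))].
  split=> [||x y Bx By|x y Bx By|x y Bx By].
  - by rewrite -f0 in B0.
  - by rewrite -f1 in B1.
  - by have := BI _ _ Bx By; rewrite -fI.
  - by have := BU _ _ Bx By; rewrite -fU.
  - by have := Bi _ _ Bx By; rewrite -fi.
move=> [x genx <-]; apply: (genx (SubHeyting closed)) => y [w yw] /=.
by rewrite yw; have [v ->] := haut_principal f w; exact: Fbreve_principal.
Qed.

Lemma Fbreve_invariant : aut_invariant (Fbreve n).
Proof.
move=> f; apply/seteqP; split=> [_ [a Ba <-]|a Ba]; first exact: Fbreve_haut.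
by exists (f^-1%g a); [exact: Fbreve_haut|rewrite hautVK].
Qed.

End Breve.

(** * Automorphism groups of dense subalgebras *)

Theorem corollary6p4 (R : realType) (n : nat) (hn : (0 < n)%N) :
  (forall H : subHeyting (Fhat n), metric_dense R H ->
     isog_perm_subgroup (hAut (sh_type H)) n) /\
  (forall H : subHeyting (Fhat n), metric_dense R H -> aut_invariant H ->
     isog_Sym (hAut (sh_type H)) n) /\
  (metric_dense R (sh_full (Fhat n)) /\ aut_invariant (sh_full (Fhat n))) /\
  (metric_dense R (Fbreve n) /\ aut_invariant (Fbreve n)).
Proof.
have val_le (H : subHeyting (Fhat n)) :
    {mono (fun x : sh_type H => val x) : x y / (x <= y)%O} by move=> x y.
have val_finite (H : subHeyting (Fhat n)) : metric_dense R H ->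
    forall a : Fhat n, finite_set (val a) -> exists x : sh_type H, val x = a.
  move=> Hdense a /(dense_finite Hdense) Ha.
  by exists (exist _ a (mem_set Ha)).
split=> [H Hdense|].
  exact: haut_isog_perm_subgroup (val_le H) (val_finite H Hdense).
split=> [H Hdense Hinv|].
  (* Surjectivity: by invariance [hact s] restricts to [H], and the restriction tracks [s]. *)
  apply: haut_isog_Sym (val_le H) (val_finite H Hdense) _ => s.
  have [g gE] := haut_restrict (Hinv (hact s)).
  by exists g => x w; rewrite gE hactP.
split; split.
- exact: finite_dense.
- move=> f; apply/seteqP; split=> // a _; exists (f^-1%g a) => //.
  exact: hautVK.
- by apply: finite_dense => a; exact: Fbreve_finite.
- exact: Fbreve_invariant.
Qed.
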